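(* Let $\mathcal{R}$ be a commutative domain with $\frac12\in\mathcal{R}$, let $n\geq 2$, and let $\mathcal{T}_n(\mathcal{R})$ be the algebra of all $n\times n$ upper triangular matrices over $\mathcal{R}$. If $\mathfrak{l}\colon\mathcal{T}_n(\mathcal{R})\to\mathcal{T}_n(\mathcal{R})$ is a Lie triple isomorphism, then $\mathfrak{l}=\pm\mathfrak{m}+\mathfrak{n}$ (that is, $\mathfrak{l}=\mathfrak{m}+\mathfrak{n}$ or $\mathfrak{l}=-\mathfrak{m}+\mathfrak{n}$), where $\mathfrak{m}\colon\mathcal{T}_n(\mathcal{R})\to\mathcal{T}_n(\mathcal{R})$ is an isomorphism or an anti-isomorphism and $\mathfrak{n}\colon\mathcal{T}_n(\mathcal{R})\to\mathcal{R}1$ is an $\mathcal{R}$-linear mapping vanishing on each second commutator $[[x,y],z]$.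
   Context: $\mathcal{R}$ has an identity, $1$ denotes the identity matrix in $\mathcal{R}1$, and $[x,y]=xy-yx$. A Lie triple isomorphism $\mathfrak{l}\colon\mathcal{A}\to\mathcal{B}$ of $\mathcal{R}$-algebras is an $\mathcal{R}$-linear bijective mapping with $\mathfrak{l}([[a,b],c])=[[\mathfrak{l}(a),\mathfrak{l}(b)],\mathfrak{l}(c)]$ for all $a,b,c\in\mathcal{A}$. Isomorphisms and anti-isomorphisms are of $\mathcal{R}$-algebras (an anti-isomorphism is an $\mathcal{R}$-linear bijection reversing products). *)

(* Defs.v *)
From HB Require Import structures.
From mathcomp Require Import all_boot all_order all_algebra.

Set Implicit Arguments.
Unset Strict Implicit.
Unset Printing Implicit Defensive.

Import GRing.Theory.

Local Open Scope ring_scope.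

Definition lie_bracket (A : pzRingType) (x y : A) : A := x * y - y * x.

Section AlgebraMaps.

Variables (R : comNzRingType) (A B : algType R).

Definition lie_triple_isomorphism (f : A -> B) : Prop :=
  [/\ linear f, bijective f
    & forall a b c, f (lie_bracket (lie_bracket a b) c)
                    = lie_bracket (lie_bracket (f a) (f b)) (f c)].

Definition algebra_isomorphism (f : A -> B) : Prop :=
  [/\ linear f, bijective f & GRing.monoid_morphism f].

Definition algebra_anti_isomorphism (f : A -> B) : Prop :=
  [/\ linear f, bijective f & forall x y, f (x * y) = f y * f x].

End AlgebraMaps.

(* The library predicate [is_trig_mx] means lower triangular, hence the
   transpose. *)
Definition upper_trig_mx (R : nmodType) (n : nat) : pred 'M[R]_n :=
  fun M => is_trig_mx M^T.

Lemma upper_trig_mxP (R : nmodType) (n : nat) (M : 'M[R]_n) :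
  reflect (forall i j : 'I_n, (j < i)%N -> M i j = 0) (upper_trig_mx M).
Proof.
apply: (iffP is_trig_mxP) => M0 i j lt_ij; last by rewrite mxE M0.
by have := M0 j i lt_ij; rewrite mxE.
Qed.

Lemma upper_trig_mx_subsemialg_closed (R : comNzRingType) (n : nat) :
  GRing.subsemialg_closed (@upper_trig_mx R n.+1).
Proof.
apply: GRing.subalg_closed_semi; split.
- by apply/upper_trig_mxP => i j lt_ji; rewrite mxE -val_eqE gtn_eqF.
- move=> a M N /upper_trig_mxP M0 /upper_trig_mxP N0.
  by apply/upper_trig_mxP => i j lt_ji; rewrite !mxE M0 // N0 // mulr0 addr0.
- move=> M N /upper_trig_mxP M0 /upper_trig_mxP N0.
  apply/upper_trig_mxP => i j lt_ji; rewrite mxE big1 // => k _.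
  have [lt_ki|le_ik] := ltnP k i; first by rewrite M0 // mul0r.
  by rewrite N0 ?mulr0 // (leq_trans lt_ji).
Qed.

Record upper_trig (R : nmodType) (n : nat) := UpperTrig {
  upper_trig_val :> 'M[R]_n;
  upper_trig_valP : upper_trig_mx upper_trig_val
}.

Notation "''T[' R ]_ n" := (upper_trig R n)
  (at level 8, n at level 2, format "''T[' R ]_ n") : type_scope.

HB.instance Definition _ (R : nmodType) (n : nat) :=
  [isSub for @upper_trig_val R n].
HB.instance Definition _ (R : nmodType) (n : nat) :=
  [Choice of 'T[R]_n by <:].
(* A zero-size matrix ring is trivial, so the (nontrivial) algebra structure
   is available in size [n.+1] only. *)
HB.instance Definition _ (R : comNzRingType) (n : nat) :=
  GRing.SubChoice_isSubAlgebra.Build R 'M[R]_n.+1 (@upper_trig_mx R n.+1)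
    'T[R]_n.+1 (@upper_trig_mx_subsemialg_closed R n).

(* Main.v *)
(* Write N for the strictly upper triangular matrices. A Lie triple isomorphism
   l preserves the powers N^k (k > 0), since they are spanned by second
   commutators of elements of lower powers. On the (p, p+k) entry of N^k/N^{k+1},
   the operator x |-> [[x, a], b] is multiplication by chi(a) chi(b), where
   chi(a) = a_pp - a_{p+k,p+k}; hence l permutes these characters up to sign.
   Comparing k = 1 and k = 2, the permutation of the simple characters preserves
   adjacency, so it is the identity or the reversal, with a constant sign.
   Composing with a sign and with the transposition along the antidiagonal, one
   may assume l(a) - a in N + R1; then l = m + nu with nu scalar, m a Lie triple
   map and m(a) - a in N. The matrices m(e_pp) commute, so a unitriangular
   conjugation takes them back to e_pp, after which m multiplies each entry
   (p, q) by a scalar c_pq with c_pq c_qr = c_pr, and is thus multiplicative. *)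
Require Import Defs.
From mathcomp Require Import all_boot all_order all_algebra.
From mathcomp Require Import ring zify.

Set Implicit Arguments.
Unset Strict Implicit.
Unset Printing Implicit Defensive.

Import GRing.Theory.

Local Open Scope ring_scope.

Lemma bracketZl (R : comNzRingType) (A : algType R) r (x y : A) :
  lie_bracket (r *: x) y = r *: lie_bracket x y.
Proof. by rewrite /lie_bracket scalerBr scalerAl scalerAr. Qed.

Lemma bracketZr (R : comNzRingType) (A : algType R) r (x y : A) :
  lie_bracket x (r *: y) = r *: lie_bracket x y.
Proof. by rewrite /lie_bracket scalerBr scalerAr scalerAl. Qed.

(** * Upper triangular matrices: entries, matrix units, powers of N, centre *)

Section UpperTrig.
Variables (R : comNzRingType) (n : nat).
Local Notation T := 'T[R]_n.+1.
Implicit Types (x y z a b c : T) (i j p q h f : 'I_n.+1) (k m : nat).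

Lemma utP x y : (forall i j, x i j = y i j) -> x = y.
Proof. by move=> e; apply/val_inj/matrixP. Qed.

Lemma ut0E i j : (0 : T) i j = 0.
Proof. by rewrite [upper_trig_val _](raddf0 (\val : T -> 'M_n.+1)) mxE. Qed.

Lemma utDE x y i j : (x + y) i j = x i j + y i j.
Proof. by rewrite [upper_trig_val _](raddfD (\val : T -> 'M_n.+1)) mxE. Qed.

Lemma utNE x i j : (- x) i j = - x i j.
Proof. by rewrite [upper_trig_val _](raddfN (\val : T -> 'M_n.+1)) mxE. Qed.

Lemma utBE x y i j : (x - y) i j = x i j - y i j.
Proof. by rewrite utDE utNE. Qed.

Lemma utZE r x i j : (r *: x) i j = r * x i j.
Proof.
have -> : upper_trig_val (r *: x) = r *: upper_trig_val x.
  by exact: (linearZ_LR (\val : T -> 'M_n.+1)).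
by rewrite mxE.
Qed.

Lemma ut1E i j : (1 : T) i j = (i == j)%:R.
Proof. by rewrite [upper_trig_val _](rmorph1 (\val : T -> 'M_n.+1)) mxE. Qed.

Lemma utME x y i j : (x * y) i j = \sum_h x i h * y h j.
Proof. by rewrite [upper_trig_val _](rmorphM (\val : T -> 'M_n.+1)) mxE. Qed.

Lemma ut_lower x i j : (j < i)%N -> x i j = 0.
Proof. by move: i j; apply/upper_trig_mxP/(valP x). Qed.

Lemma ut_diagM x y i : (x * y) i i = x i i * y i i.
Proof.
rewrite utME (bigD1 i) //= big1 ?addr0 // => h /eqP ne_hi.
case: (ltngtP h i) => [lt_hi|lt_ih|/val_inj//].
  by rewrite ut_lower // mul0r.
by rewrite (ut_lower _ lt_ih) mulr0.
Qed.

Fact trunc_upper (M : 'M[R]_n.+1) :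
  upper_trig_mx (\matrix_(i, j) if (i <= j)%N then M i j else 0).
Proof. by apply/upper_trig_mxP => i j lt_ji; rewrite mxE leqNgt lt_ji. Qed.

Definition utmx M : T := UpperTrig (trunc_upper M).

Lemma utmxE M i j : (i <= j)%N -> utmx M i j = M i j.
Proof. by move=> le_ij; rewrite mxE le_ij. Qed.

(* Locked so that simplification does not reduce it to a raw matrix. *)
Definition utdelta i j : T := locked (utmx (delta_mx i j)).

Lemma utdeltaE i j p q : (i <= j)%N ->
  utdelta i j p q = ((p == i) && (q == j))%:R.
Proof.
by move=> le_ij; rewrite /utdelta -lock !mxE; case: leqP => //; case: eqP => [->|//];
  case: eqP => // ->; rewrite ltnNge le_ij.
Qed.

Lemma mul_utdeltal i j x p q : (i <= j)%N ->
  (utdelta i j * x) p q = (p == i)%:R * x j q.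
Proof.
move=> le_ij; rewrite utME (bigD1 j) //= big1 ?addr0 => [|h /negPf ne_hj].
  by rewrite utdeltaE // eqxx andbT.
by rewrite utdeltaE // ne_hj andbF mul0r.
Qed.

Lemma mul_utdeltar i j x p q : (i <= j)%N ->
  (x * utdelta i j) p q = x p i * (q == j)%:R.
Proof.
move=> le_ij; rewrite utME (bigD1 i) //= big1 ?addr0 => [|h /negPf ne_hj].
  by rewrite utdeltaE // eqxx.
by rewrite utdeltaE // ne_hj mulr0.
Qed.

Lemma utdeltaM i j h : (i <= j)%N -> (j <= h)%N ->
  utdelta i j * utdelta j h = utdelta i h.
Proof.
move=> le_ij le_jh; apply: utP => p q.
rewrite mul_utdeltal // !utdeltaE ?(leq_trans le_ij) // eqxx /=.
by rewrite -natrM mulnb.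
Qed.

Lemma utdeltaM0 i j h f : (i <= j)%N -> (h <= f)%N -> j != h ->
  utdelta i j * utdelta h f = 0.
Proof.
move=> le_ij le_hf /negPf ne_jh; apply: utP => p q.
by rewrite mul_utdeltal // utdeltaE // ne_jh mulr0 ut0E.
Qed.

(* The k-th power of the ideal of strictly upper triangular matrices. *)
Definition strict k x := forall i j, (j < i + k)%N -> x i j = 0.

Lemma strict0 k : strict k 0.
Proof. by move=> i j _; rewrite ut0E. Qed.

Lemma strict_top x : strict n.+1 x -> x = 0.
Proof.
by move=> x0; apply: utP => i j; rewrite x0 ?ut0E // ltn_addl.
Qed.

Lemma strictN k x : strict k x -> strict k (- x).
Proof. by move=> x0 i j lt_j; rewrite utNE x0 // oppr0. Qed.

Lemma strictD k x y : strict k x -> strict k y -> strict k (x + y).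
Proof. by move=> x0 y0 i j lt_j; rewrite utDE x0 // y0 // addr0. Qed.

Lemma strictB k x y : strict k x -> strict k y -> strict k (x - y).
Proof. by move=> x0 /strictN; apply: strictD. Qed.

Lemma strictZ k r x : strict k x -> strict k (r *: x).
Proof. by move=> x0 i j lt_j; rewrite utZE x0 // mulr0. Qed.

Lemma strict_ut x : strict 0 x.
Proof. by move=> i j; rewrite addn0; apply: ut_lower. Qed.

Lemma strictM k m x y : strict k x -> strict m y -> strict (k + m) (x * y).
Proof.
move=> x0 y0 i j lt_j; rewrite utME big1 // => f _.
have [lt_f|le_f] := ltnP f (i + k); first by rewrite x0 ?mul0r.
by rewrite y0 ?mulr0 //; lia.
Qed.

Lemma strict_bracket k m x y :
  strict k x -> strict m y -> strict (k + m) (lie_bracket x y).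
Proof.
by move=> x0 y0; apply: strictB; [|rewrite addnC]; apply: strictM.
Qed.

Lemma bracket_diag x y i : lie_bracket x y i i = 0.
Proof. by rewrite utBE !ut_diagM mulrC subrr. Qed.

Lemma strict1P x : (forall i, x i i = 0) -> strict 1 x.
Proof.
move=> x0 i j; rewrite addn1 ltnS leq_eqVlt => /orP[/eqP/val_inj->//|].
exact: ut_lower.
Qed.

Lemma strict1_bracket x y : strict 1 (lie_bracket x y).
Proof. by apply: strict1P => i; apply: bracket_diag. Qed.

Lemma strict_utdelta k i j : (i + k <= j)%N -> strict k (utdelta i j).
Proof.
move=> le_ij p q lt_q; rewrite utdeltaE ?(leq_trans _ le_ij) ?leq_addr //.
case: eqP => //= e; case: eqP => //= f; move: lt_q; rewrite e f; lia.
Qed.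

(** A matrix in N^k is the sum of its entries times the units [utdelta i j] with [i + k <= j], so a
    linear property need only be checked on these. *)
Lemma strict_ind k (P : T -> Prop) :
  P 0 -> (forall r x y, P x -> P y -> P (r *: x + y)) ->
  (forall i j, (i + k <= j)%N -> P (utdelta i j)) ->
  forall x, strict k x -> P x.
Proof.
move=> P0 PD PE x x0.
have -> : x = \sum_(i < n.+1) \sum_(j < n.+1 | (i + k <= j)%N) x i j *: utdelta i j.
  have sumE I (r : seq I) (Q : pred I) (F : I -> T) p q :
      (\sum_(i <- r | Q i) F i) p q = \sum_(i <- r | Q i) F i p q.
    by elim/big_rec2: _ => [|i ? ? _ <-]; rewrite ?ut0E ?utDE.
  apply: utP => p q; rewrite sumE (bigD1 p) //= [X in _ + X]big1 => [|i ne_ip].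
    rewrite addr0 sumE; have [le_pq|lt_qp] := leqP (p + k) q.
      rewrite (bigD1 q) //= big1 => [|j /andP[le_pj ne_jq]].
        rewrite utZE utdeltaE ?(leq_trans _ le_pq) ?leq_addr //.
        by rewrite !eqxx mulr1 addr0.
      rewrite utZE utdeltaE ?(leq_trans _ le_pj) ?leq_addr //.
      by rewrite [q == _]eq_sym (negPf ne_jq) andbF mulr0.
    rewrite x0 // big1 // => j le_pj.
    rewrite utZE utdeltaE ?(leq_trans _ le_pj) ?leq_addr //.
    case: (q =P j) => [e|_]; last by rewrite andbF mulr0.
    by move: lt_qp; rewrite e ltnNge le_pj.
  rewrite sumE big1 // => j le_ij.
  rewrite utZE utdeltaE ?(leq_trans _ le_ij) ?leq_addr //.
  by rewrite [p == _]eq_sym (negPf ne_ip) mulr0.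
elim/big_rec: _ => // i y _ Py; elim/big_rec: _ => [|j z /PE Pij Pz].
  by rewrite add0r.
by rewrite -addrA; apply: PD.
Qed.

(* To first order along its leading superdiagonal, a strictly upper triangular
   matrix is acted upon by the diagonal parts only. *)
Lemma bracket_edge k x a p q : strict k x -> q = (p + k)%N :> nat ->
  lie_bracket x a p q = (a q q - a p p) * x p q.
Proof.
move=> x0 eq_q; case: k => [|k] in x0 eq_q *.
  have -> : q = p by apply: ord_inj; rewrite eq_q addn0.
  by rewrite bracket_diag subrr mul0r.
rewrite utBE !utME (bigD1 q) //= [X in _ + X - _]big1 => [|h ne_hq].
  rewrite (bigD1 p) //= [X in _ - (_ + X)]big1 => [|h ne_hp]; first ring.
  case: (ltngtP h p) => [lt_hp|lt_ph|/val_inj e]; last by rewrite e eqxx in ne_hp.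
    by rewrite ut_lower ?mul0r.
  by rewrite x0 ?mulr0 //; lia.
case: (ltngtP h q) => [lt_hp|lt_ph|/val_inj e]; last by rewrite e eqxx in ne_hq.
  by rewrite x0 ?mul0r //; lia.
by rewrite (ut_lower a) ?mulr0.
Qed.

Lemma strict_bracket_ut k x a : strict k x -> strict k (lie_bracket x a).
Proof. by move=> x0; rewrite -[k]addn0; apply: strict_bracket (strict_ut a). Qed.

Lemma bracket2_edge k x a b p q : strict k x -> q = (p + k)%N :> nat ->
  lie_bracket (lie_bracket x a) b p q =
    (a p p - a q q) * (b p p - b q q) * x p q.
Proof.
move=> x0 e; rewrite (bracket_edge _ (strict_bracket_ut a x0) e).
by rewrite (bracket_edge _ x0 e); ring.
Qed.

(** The outer bracket with [utdelta h h] changes nothing and only turns a bracket into a second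
    commutator. The degenerate cases [j = i] and [j = h] are included. *)
Lemma utdelta_bracket2 i j h : (i <= j)%N -> (j <= h)%N -> (i < h)%N ->
  lie_bracket (lie_bracket (utdelta i j) (utdelta j h)) (utdelta h h) =
    utdelta i h.
Proof.
move=> le_ij le_jh lt_ih; have le_ih := ltnW lt_ih.
have ne_hi : h != i by rewrite -val_eqE gtn_eqF.
rewrite /lie_bracket utdeltaM // (@utdeltaM0 j h i j) // subr0 utdeltaM //.
by rewrite utdeltaM0 // subr0.
Qed.

Lemma comm_utdelta_diag z : (forall q, z * utdelta q q = utdelta q q * z) ->
  forall p q, p != q -> z p q = 0.
Proof.
move=> zC p q /negPf ne_pq; have := congr1 (fun x : T => x p q) (zC q).
by rewrite mul_utdeltar // mul_utdeltal // eqxx mulr1 ne_pq mul0r.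
Qed.

(** Commuting with the [utdelta q q] makes [z] diagonal; commuting with [utdelta ord0 p] then
    equates each diagonal entry with the first. *)
Lemma central_scalar z : (forall a, lie_bracket z a = 0) -> z = (z ord0 ord0)%:A.
Proof.
move=> zC; have zC' a : z * a = a * z by apply/subr0_eq/zC.
apply: utP => p q; rewrite utZE ut1E; case: eqVneq => [<-|ne_pq]; last first.
  by rewrite mulr0 (@comm_utdelta_diag z).
have := congr1 (fun x : T => x ord0 p) (zC' (utdelta ord0 p)).
by rewrite mul_utdeltar // mul_utdeltal // !eqxx mulr1 mul1r => ->.
Qed.

End UpperTrig.

Arguments utdelta {R n} i j.

(** * Elementary consequences of linearity *)

Section LinearMap.
Variables (R : pzRingType) (U V : lmodType R) (f : U -> V).
Hypothesis lin_f : linear f.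

Lemma lin_add x y : f (x + y) = f x + f y.
Proof. by have := lin_f 1 x y; rewrite !scale1r. Qed.

Lemma lin0 : f 0 = 0.
Proof. by apply: (addIr (f 0)); rewrite -lin_add !add0r. Qed.

Lemma lin_scale r x : f (r *: x) = r *: f x.
Proof. by have := lin_f r x 0; rewrite lin0 !addr0. Qed.

Lemma lin_opp x : f (- x) = - f x.
Proof. by rewrite -scaleN1r lin_scale scaleN1r. Qed.

Lemma lin_sub x y : f (x - y) = f x - f y.
Proof. by rewrite lin_add lin_opp. Qed.

End LinearMap.

(** * Lie triple maps preserve the powers of N *)

Section LieTriple.
Variables (R : comNzRingType) (n : nat).
Local Notation T := 'T[R]_n.+1.
Implicit Types (x y z a b c : T) (i j p q h f : 'I_n.+1) (k m : nat) (l : T -> T).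

Definition lie_triple_hom l := forall a b c,
  l (lie_bracket (lie_bracket a b) c) = lie_bracket (lie_bracket (l a) (l b)) (l c).

Lemma lie_triple_strict l k x : linear l -> lie_triple_hom l -> (0 < k)%N ->
  strict k x -> strict k (l x).
Proof.
move=> lin_l hom_l; elim: k x => // k IHk x _.
apply: (strict_ind (P := fun x => strict k.+1 (l x))) => [|r y z ly lz|i j le_ij].
- by rewrite (lin0 lin_l); apply: strict0.
- by rewrite lin_l; apply: strictD => //; apply: strictZ.
case: k => [|k] in IHk le_ij *.
  rewrite -(@utdelta_bracket2 _ _ i i j) //; try lia.
  by rewrite hom_l; apply: strict1_bracket.
have lt_i : (i.+1 < n.+1)%N by have := ltn_ord j; lia.
(* Factoring through [i + 1] leaves one factor in N and one in the previous power, covered by the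
   induction hypothesis. *)
rewrite -(@utdelta_bracket2 _ _ i (Ordinal lt_i) j) /=; try lia.
rewrite hom_l; apply: strict_bracket_ut; rewrite -add1n.
apply: strict_bracket; last by apply: IHk => //; apply: strict_utdelta => /=; lia.
rewrite -(@utdelta_bracket2 _ _ i i (Ordinal lt_i)) //=.
by rewrite hom_l; apply: strict1_bracket.
Qed.

Lemma lie_triple_inv l l' : linear l -> lie_triple_hom l ->
  cancel l l' -> cancel l' l -> linear l' /\ lie_triple_hom l'.
Proof.
move=> lin_l hom_l lK l'K; split=> [r x y|a b c]; apply: (can_inj lK).
  by rewrite lin_l !l'K.
by rewrite hom_l !l'K.
Qed.

End LieTriple.

(** * Pullback of the characters a_pp - a_qq *)

Section Roots.
Variables (R : idomainType) (n : nat).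
Local Notation T := 'T[R]_n.+1.
Implicit Types (x y z a b c : T) (i j p q h f : 'I_n.+1) (k : nat) (l : T -> T).

Lemma lie_triple_root l k p q : linear l -> bijective l -> lie_triple_hom l ->
    (0 < k)%N -> q = (p + k)%N :> nat ->
  exists p' q' (e : R), [/\ q' = (p' + k)%N :> nat, e = 1 \/ e = -1
    & forall a, l a p p - l a q q = e * (a p' p' - a q' q')].
Proof.
move=> lin_l [l' lK l'K] hom_l k_gt0 eq_q.
have [lin_l' hom_l'] := lie_triple_inv lin_l hom_l lK l'K.
have [/existsP[p' /existsP[q' /andP[/eqP eq_q' nz_l]]]|no_pq] :=
    boolP [exists p' : 'I_n.+1, exists q' : 'I_n.+1,
      (q' == p' + k :> nat)%N && (l (utdelta p' q') p q != 0)]; last first.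
  (* If no unit on the k-th superdiagonal had an image with nonzero (p, q) entry, this entry of [l]
     would vanish on all of N^k, since N^(k+1) is preserved. As [l'] also preserves N^k,
     [l' (utdelta p q)] gives a contradiction. *)
  have l0 x : strict k x -> l x p q = 0.
    apply: (strict_ind (P := fun x => l x p q = 0)) => [|r y z ly lz|i j le_ij].
    - by rewrite (lin0 lin_l) ut0E.
    - by rewrite lin_l utDE utZE ly lz mulr0 addr0.
    move: le_ij; rewrite leq_eqVlt => /orP[/eqP eq_j|lt_ij].
      move/existsPn/(_ i)/existsPn/(_ j): no_pq.
      by rewrite eq_j eqxx negbK => /eqP.
    have : strict k.+1 (utdelta i j : T) by apply: strict_utdelta; lia.
    by move/(lie_triple_strict lin_l hom_l (ltn0Sn k)); apply; lia.
  have := l0 (l' (utdelta p q)); rewrite l'K utdeltaE; last by lia.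
  rewrite !eqxx => /(_ (lie_triple_strict lin_l' hom_l' k_gt0 _)).
  move=> abs; suff: (1 : R) = 0 by move/eqP; rewrite oner_eq0.
  by apply: abs; apply: strict_utdelta; lia.
set L := l _ p q in nz_l.
have sE : strict k (utdelta p' q' : T) by apply: strict_utdelta; lia.
have le_p'q' : (p' <= q')%N by lia.
(* Applying [l] to the double bracket of the unit with [a] and [b], and reading the (p, q) entry in
   two ways, gives both sides times [L], which is nonzero and cancels. *)
have key a b : (a p' p' - a q' q') * (b p' p' - b q' q') =
               (l a p p - l a q q) * (l b p p - l b q q).
  apply: (mulIf nz_l).
  have slE := lie_triple_strict lin_l hom_l k_gt0 sE.
  rewrite -(bracket2_edge _ _ slE eq_q) -hom_l.
  set y := lie_bracket _ _; set r := _ * (b p' p' - _).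
  have -> : y = r *: utdelta p' q' + (y - r *: utdelta p' q') by rewrite addrC subrK.
  (* The double bracket is a multiple of the unit modulo N^(k+1), and [l] keeps the remainder there,
     where the (p, q) entry is zero. *)
  have ys : strict k.+1 (y - r *: utdelta p' q').
    move=> i j lt_j; rewrite utBE utZE.
    have sy : strict k y by do 2!apply: strict_bracket_ut.
    have [eq_j|ne_j] := eqVneq (nat_of_ord j) (i + k)%N; last first.
      by rewrite sy ?sE ?mulr0 ?subr0 //; lia.
    rewrite (bracket2_edge _ _ sE eq_j) utdeltaE //.
    case: (i =P p') => [->|_]; last by rewrite !mulr0 subr0.
    by case: (j =P q') => [->|_]; rewrite ?mulr1 ?mulr0 subrr.
  rewrite (lin_add lin_l) utDE [X in _ = _ + X](lie_triple_strict lin_l hom_l _ ys) //;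
    last lia.
  by rewrite addr0 (lin_scale lin_l) utZE.
(* The character at (p', q') takes the value 1 on this [b], so [key] gives first that [e] squares to
   1, then the linear relation. *)
set b : T := utdelta p' p'; set e := l b p p - l b q q.
have b1 : b p' p' - b q' q' = 1.
  rewrite !utdeltaE // eqxx -val_eqE /= eq_q' -[X in _ == X]addn0 eqn_add2l.
  by rewrite (gtn_eqF k_gt0) subr0.
have e2 : e * e = 1 by rewrite /e -key b1 mulr1.
exists p', q', e; split=> // [|a].
  by have /eqP := e2; rewrite -expr2 sqrf_eq1 => /orP[]/eqP; [left|right].
by rewrite -[LHS]mulr1 -e2 mulrC -mulrA -[e * (l a p p - _)]mulrC -key b1 mulr1.
Qed.

End Roots.

(** * Maps that preserve diagonals, up to scalars: multiplicativity *)

Section FixedDiagonal.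
Variables (R : comNzRingType) (n : nat).
Local Notation T := 'T[R]_n.+1.
Implicit Types (x y z a b c : T) (i j p q h f : 'I_n.+1) (k : nat) (l m : T -> T).

Lemma ut_sumE (I : Type) (r : seq I) (Q : pred I) (F : I -> T) p q :
  (\sum_(i <- r | Q i) F i) p q = \sum_(i <- r | Q i) F i p q.
Proof. by elim/big_rec2: _ => [|i ? ? _ <-]; rewrite ?ut0E ?utDE. Qed.

Lemma sum_utdelta : \sum_p utdelta p p = 1 :> T.
Proof.
apply: utP => i j; rewrite ut_sumE ut1E (bigD1 i) //= big1 => [|p /negPf ne_pi].
  by rewrite utdeltaE // eqxx addr0 eq_sym.
by rewrite utdeltaE // eq_sym ne_pi.
Qed.

(** Two of the four terms contain a product of orthogonal idempotents, and a third picks an entry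
    below the diagonal. What is left isolates one entry in a form that a Lie triple map respects. *)
Lemma corner_bracket x p q : (p < q)%N ->
  lie_bracket (lie_bracket (utdelta p p) x) (utdelta q q) = x p q *: utdelta p q.
Proof.
move=> lt_pq; have ne_pq : p != q by rewrite -val_eqE ltn_eqF.
have eqp : utdelta q q * utdelta p p = 0 :> T by rewrite utdeltaM0 // eq_sym.
have epq : utdelta p p * utdelta q q = 0 :> T by rewrite utdeltaM0.
have -> : lie_bracket (lie_bracket (utdelta p p) x) (utdelta q q) =
    utdelta p p * (x * utdelta q q) + utdelta q q * (x * utdelta p p).
  rewrite /lie_bracket !mulrBl !mulrBr !mulrA eqp mul0r -[x * _ * _]mulrA epq.
  by rewrite mulr0 subr0 sub0r opprK.
apply: utP => i j; rewrite utDE !mul_utdeltal // !mul_utdeltar //.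
rewrite (ut_lower x lt_pq) mul0r mulr0 addr0 utZE utdeltaE 1?ltnW //.
by rewrite -mulnb natrM mulrCA.
Qed.

Lemma lie_triple_mul_fixed m : linear m -> lie_triple_hom m ->
    (forall x i, m x i i = x i i) -> (forall q, m (utdelta q q) = utdelta q q) ->
  forall x y, m (x * y) = m x * m y.
Proof.
move=> lin_m hom_m diag_m fix_m.
pose c p q := m (utdelta p q) p q.
have cpp p : c p p = 1 by rewrite /c fix_m utdeltaE // eqxx.
have mE x p q : (p <= q)%N -> m x p q = x p q * c p q.
  rewrite leq_eqVlt => /orP[/eqP/val_inj<-|lt_pq].
    by rewrite cpp mulr1 diag_m.
  have := hom_m (utdelta p p) x (utdelta q q).
  rewrite !fix_m !corner_bracket // (lin_scale lin_m).
  move/(congr1 (fun x : T => x p q)); rewrite !utZE => ->.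
  by rewrite utdeltaE ?eqxx ?mulr1 // ltnW.
have mdelta p q : (p <= q)%N -> m (utdelta p q) = c p q *: utdelta p q.
  move=> le_pq; apply: utP => i j; have [le_ij|lt_ji] := leqP i j; last first.
    by rewrite !ut_lower.
  rewrite mE // utZE utdeltaE //.
  by case: eqP => [->|]; case: eqP => [->|]; rewrite ?mul0r ?mulr0 ?mul1r ?mulr1.
(* The second commutator that builds a unit from two others gives the relation when [p < h];
   otherwise the three indices coincide. *)
have cM p q h : (p <= q)%N -> (q <= h)%N -> c p h = c p q * c q h.
  move=> le_pq le_qh; have [lt_ph|le_hp] := ltnP p h; last first.
    have e : q = p by apply: ord_inj; lia.
    have -> : h = p by apply: ord_inj; lia.
    by rewrite e cpp mulr1.
  rewrite {1}/c -(utdelta_bracket2 _ le_pq le_qh lt_ph) hom_m fix_m.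
  rewrite !mdelta // -[RHS]mulr1.
  rewrite bracketZl bracketZr !bracketZl scalerA.
  by rewrite utdelta_bracket2 // utZE utdeltaE ?eqxx // ltnW.
move=> x y; apply: utP => i j; have [le_ij|lt_ji] := leqP i j; last first.
  by rewrite !ut_lower.
rewrite mE // !utME mulr_suml; apply: eq_bigr => q _.
have [le_iq|lt_qi] := leqP i q; last by rewrite !(ut_lower _ lt_qi) !mul0r.
have [le_qj|lt_jq] := leqP q j; last by rewrite !(ut_lower _ lt_jq) !mulr0 mul0r.
by rewrite !mE // (cM i q j) //; ring.
Qed.

(** [1 - x] is nilpotent, so the geometric series terminates. *)
Lemma unitriangular_inv x : (forall i, x i i = 1) ->
  exists y : T, x * y = 1 /\ y * x = 1.
Proof.
move=> x1; have sx : strict 1 (1 - x).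
  by apply: strict1P => i; rewrite utBE x1 ut1E eqxx subrr.
have nil k : strict k ((1 - x) ^+ k).
  elim: k => [|k IHk]; first by apply: strict_ut.
  by rewrite exprS -add1n; apply: strictM.
have X0 := strict_top (nil n.+1).
have xS : x * (\sum_(i < n.+1) (1 - x) ^+ i) = 1.
  have := subrX1 (1 - x) n.+1; rewrite X0 addrAC subrr !sub0r mulNr.
  by move/oppr_inj.
exists (\sum_(i < n.+1) (1 - x) ^+ i); split=> //; rewrite -[RHS]xS; apply/esym.
apply: commr_sum => i _; apply: commrX; apply: commrB; first exact: commr1.
exact: commr_refl.
Qed.

(* The row [p] of the intertwiner [g] is a common left eigenvector of the
   commuting family [d], with eigenvalue [p == q] for [d q]: right
   multiplication by [1 - d r] sends the rows supported on columns [>= r] to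
   rows supported on columns [> r]. *)
Lemma unitriangular_diag (d : 'I_n.+1 -> T) :
    (forall p q, d p * d q = d q * d p) ->
    (forall p i, d p i i = utdelta p p i i) ->
  exists g : T, (forall i, g i i = 1) /\ (forall q, g * d q = utdelta q q * g).
Proof.
move=> dC dE.
pose G k := \prod_(k <= r < n.+1) (1 - d (inord r)).
have dE' p i : d p i i = (i == p)%:R by rewrite dE utdeltaE // andbb.
(* The factor of index [k] clears column [k] of [y], its own diagonal entry there being 0, and
   triangularity keeps the earlier columns zero. The induction is on the number of columns left. *)
have G0 k y : (k <= n.+1)%N -> (forall i j, (j < k)%N -> y i j = 0) -> y * G k = 0.
  move=> le_k; rewrite -(subKn le_k).
  elim: (n.+1 - k)%N (leq_subr k n.+1) y => [_ y y0|{le_k}k IHk lt_k y y0].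
    rewrite /G big_geq ?subn0 // mulr1.
    by apply: strict_top => i j _; apply: y0; rewrite subn0.
  have e : (n.+1 - k = (n.+1 - k.+1).+1)%N by lia.
  rewrite /G big_ltn ?mulrA -?e; last by lia.
  apply: IHk => [|i j lt_j]; first by lia.
  rewrite utME big1 // => h _; have [lt_h|le_h] := ltnP h (n.+1 - k.+1).
    by rewrite y0 ?mul0r.
  have [lt_jh|le_hj] := ltnP j h; first by rewrite (ut_lower _ lt_jh) mulr0.
  have -> : j = h by apply: ord_inj; lia.
  rewrite utBE ut1E dE' eqxx.
  have -> : (h == inord (n.+1 - k.+1)); last by rewrite subrr mulr0.
  by rewrite -val_eqE /= inordK; lia.
have dG q k : d q * G k = G k * d q.
  apply: commr_prod => r _; apply: commrB; [exact: commr1|exact: dC].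
(* Row [p] of [d q] minus the scalar [(p == q)] starts at column [p] by triangularity and vanishes
   there too, so [G p.+1] annihilates it. *)
have eigen p q : utdelta p p * G p.+1 * d q = (p == q)%:R * (utdelta p p * G p.+1).
  rewrite -mulrA -dG; apply/subr0_eq; rewrite !mulrA -mulrBl.
  apply: G0 => // i j; rewrite ltnS => le_jp.
  rewrite utBE -scaler_nat -scalerAl mul1r utZE mul_utdeltal // utdeltaE //.
  case: (i =P p) => [_|_]; last by rewrite mul0r mulr0 subrr.
  have [->|lt_jp] := eqVneq j p; first by rewrite dE' mulr1 mul1r subrr.
  rewrite ut_lower ?mulr0 ?subrr // ltn_neqAle le_jp andbT.
  by rewrite val_eqE lt_jp.
(* Row [p] is that of [G p.+1], whose factors all have (p, p) entry 1. *)
exists (\sum_p utdelta p p * G p.+1); split=> [i|q].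
  rewrite ut_sumE (bigD1 i) //= big1 => [|p /negPf ne_pi].
    rewrite mul_utdeltal // eqxx mul1r addr0 /G big_nat.
    elim/big_rec: _ => [|r x]; first by rewrite ut1E eqxx.
    move=> /andP[lt_ir lt_r]; rewrite ut_diagM utBE ut1E eqxx dE' => ->.
    by rewrite -val_eqE /= inordK // ltn_eqF // subr0 mulr1.
  by rewrite mul_utdeltal // eq_sym ne_pi mul0r.
rewrite mulr_suml mulr_sumr; apply: eq_bigr => p _.
rewrite eigen [RHS]mulrA; case: eqVneq => [->|ne_pq]; first by rewrite utdeltaM // mul1r.
by rewrite utdeltaM0 1?eq_sym // !mul0r.
Qed.

(** The hypothesis on centralisers stands in for surjectivity of [m], not yet known when the lemma
    is applied. *)
Lemma lie_triple_unipotent_monoid m : linear m -> lie_triple_hom m ->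
    (forall z, (forall a, lie_bracket z (m a) = 0) -> forall a, lie_bracket z a = 0) ->
  (forall x i, m x i i = x i i) -> GRing.monoid_morphism m.
Proof.
move=> lin_m hom_m cent_m diag_m.
have dC p q : m (utdelta p p) * m (utdelta q q) = m (utdelta q q) * m (utdelta p p).
  apply/subr0_eq; rewrite -/(lie_bracket _ _).
  (* The bracket of these two images commutes with the image of [m], so it is scalar; having zero
     diagonal, it is zero. *)
  have /cent_m/central_scalar-> : forall a,
      lie_bracket (lie_bracket (m (utdelta p p)) (m (utdelta q q))) (m a) = 0.
    move=> a; rewrite -hom_m; have -> : lie_bracket (utdelta p p) (utdelta q q) = 0 :> T.
      rewrite /lie_bracket; have [->|ne_pq] := eqVneq p q; first by rewrite subrr.
      by have ne_qp := ne_pq; rewrite eq_sym in ne_qp; rewrite !utdeltaM0 // subrr.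
    by rewrite /lie_bracket mulr0 mul0r subrr (lin0 lin_m).
  by rewrite bracket_diag scale0r.
have [g [g1 gd]] := unitriangular_diag dC (fun p i => diag_m (utdelta p p) i).
have [h [gh hg]] := unitriangular_inv g1.
pose m' x := g * m x * h.
have lin_m' : linear m'.
  by move=> r x y; rewrite /m' lin_m mulrDr mulrDl -scalerAr -scalerAl.
have conjM x y : g * (x * y) * h = (g * x * h) * (g * y * h).
  by rewrite !mulrA -[g * x * h * g]mulrA hg mulr1.
have conj_br x y : g * lie_bracket x y * h = lie_bracket (g * x * h) (g * y * h).
  by rewrite /lie_bracket mulrBr mulrBl !conjM.
have hom_m' : lie_triple_hom m' by move=> a b c; rewrite /m' hom_m !conj_br.
have diag_m' x i : m' x i i = x i i.
  have : (g * h) i i = 1 by rewrite gh ut1E eqxx.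
  by rewrite !ut_diagM g1 !mul1r => ->; rewrite mulr1 diag_m.
have fix_m' q : m' (utdelta q q) = utdelta q q by rewrite /m' gd -mulrA gh mulr1.
have mE x : m x = h * m' x * g by rewrite /m' !mulrA hg mul1r -mulrA hg mulr1.
clearbody m'; split=> [|x y].
  rewrite mE; suff -> : m' 1 = 1 by rewrite mulr1 hg.
  rewrite -sum_utdelta (big_morph m' (lin_add lin_m') (lin0 lin_m')).
  exact: eq_bigr.
rewrite !mE (lie_triple_mul_fixed lin_m' hom_m') // !mulrA.
by rewrite -[h * m' x * g * h]mulrA gh mulr1.
Qed.

(** [nu x] is the scalar matrix of the common diagonal shift. It vanishes on N, hence on second
    commutators, and subtracting it does not affect brackets. *)
Lemma lie_triple_unipotent l : linear l -> bijective l -> lie_triple_hom l ->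
    (forall x i, l x i i - x i i = l x ord0 ord0 - x ord0 ord0) ->
  exists m nu : T -> T,
    [/\ algebra_isomorphism m, linear nu,
        forall x, exists r : R, nu x = r%:A,
        forall x y z, nu (lie_bracket (lie_bracket x y) z) = 0
      & forall x, l x = m x + nu x].
Proof.
move=> lin_l [l' lK l'K] hom_l diag_l.
pose c x := l x ord0 ord0 - x ord0 ord0.
pose nu x : T := (c x)%:A; pose m x := l x - nu x.
have cD r x y : c (r *: x + y) = r * c x + c y.
  by rewrite /c lin_l !utDE !utZE; ring.
have lin_nu : linear nu by move=> r x y; rewrite /nu cD scalerDl -scalerA.
have lin_m : linear m.
  by move=> r x y; rewrite /m lin_l lin_nu scalerBr opprD addrACA.
have nu0 x : strict 1 x -> nu x = 0.
  move=> sx; rewrite /nu /c sx // (lie_triple_strict lin_l hom_l _ sx) //.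
  by rewrite subrr scale0r.
have nuC r x : x * (r%:A : T) = r%:A * x by rewrite -scalerAl -scalerAr mulr1 mul1r.
have brC r x y : lie_bracket (x - r%:A) y = lie_bracket x y.
  by rewrite /lie_bracket mulrBl mulrBr nuC opprB addrA subrK.
have brC' r x y : lie_bracket y (x - r%:A) = lie_bracket y x.
  by rewrite /lie_bracket mulrBl mulrBr nuC opprB addrA subrK.
have hom_m : lie_triple_hom m.
  move=> a b d; rewrite {1}/m nu0; last exact: strict1_bracket.
  by rewrite subr0 hom_l (brC (c a)) (brC' (c b)) (brC' (c d)).
have diag_m x i : m x i i = x i i.
  by rewrite /m utBE /nu utZE ut1E eqxx mulr1 /c -(diag_l x i) subKr.
have cent_m z : (forall a, lie_bracket z (m a) = 0) -> forall a, lie_bracket z a = 0.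
  by move=> zC a; rewrite -[a]l'K -(brC' (c (l' a))) zC.
have [m1 mM] := lie_triple_unipotent_monoid lin_m hom_m cent_m diag_m.
(* An element killed by [m] has zero diagonal, hence lies in N, where [m] and [l] agree. *)
have inj_m : injective m.
  move=> x y /eqP; rewrite -subr_eq0 -(lin_sub lin_m) => /eqP m0.
  have : l (x - y) = 0.
    rewrite -[LHS](subrK (nu (x - y))) -/(m _) m0 add0r nu0 //.
    by apply: strict1P => i; rewrite -diag_m m0 ut0E.
  by rewrite (lin_sub lin_l) => /subr0_eq /(can_inj lK).
exists m, nu; split=> // [|x|x y z|x].
(* As [m] fixes scalar matrices, the added term restores what [m] subtracts from [l]. *)
- split=> //; exists (fun y => l' y + nu (l' y)); last first.
    move=> y; rewrite (lin_add lin_m) (lin_scale lin_m) m1 /m l'K subrK //.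
  move=> x; apply: inj_m.
  by rewrite (lin_add lin_m) (lin_scale lin_m) m1 [m (l' _)]/m l'K subrK.
- by exists (c x).
- by apply/nu0/strict1_bracket.
- by rewrite subrK.
Qed.

End FixedDiagonal.

(** * Transposition along the antidiagonal *)

Section AntiTranspose.
Variables (R : comNzRingType) (n : nat).
Local Notation T := 'T[R]_n.+1.
Implicit Types (x y z : T) (i j : 'I_n.+1).

(** Unlike the ordinary transposition, this reflection preserves upper triangularity; the truncation
    in [utmx] discards only zeros. *)
Definition antitr x : T := utmx (\matrix_(i, j) x (rev_ord j) (rev_ord i)).

Lemma antitrE x i j : antitr x i j = x (rev_ord j) (rev_ord i).
Proof.
have [le_ij|lt_ji] := leqP i j; first by rewrite utmxE // mxE.
by rewrite !ut_lower //=; have := ltn_ord i; lia.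
Qed.

Lemma antitrK : involutive antitr.
Proof. by move=> x; apply: utP => i j; rewrite !antitrE !rev_ordK. Qed.

Lemma antitr_linear : linear antitr.
Proof.
move=> r x y; apply: utP => i j.
by rewrite utDE utZE !antitrE utDE utZE.
Qed.

Lemma antitrM x y : antitr (x * y) = antitr y * antitr x.
Proof.
apply: utP => i j; rewrite antitrE !utME (reindex_inj rev_ord_inj) /=.
by apply: eq_bigr => h _; rewrite !antitrE mulrC.
Qed.

(** An anti-automorphism changes the sign of a bracket, and the two signs cancel. *)
Lemma antitr_bracket2 x y z : antitr (lie_bracket (lie_bracket x y) z) =
  lie_bracket (lie_bracket (antitr x) (antitr y)) (antitr z).
Proof.
rewrite /lie_bracket !(lin_sub antitr_linear) !antitrM !(lin_sub antitr_linear) !antitrM.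
by rewrite -[antitr y * _ - _]opprB mulrN mulNr opprK addrC.
Qed.

End AntiTranspose.

(** * The induced action on diagonals *)

Lemma adjacent_injection (s : nat -> nat) k :
    (forall j, (j <= k)%N -> (s j <= k)%N) ->
    (forall i j, (i <= k)%N -> (j <= k)%N -> s i = s j -> i = j) ->
    (forall j, (j < k)%N -> s j.+1 = (s j).+1 \/ s j = (s j.+1).+1) ->
  (forall j, (j <= k)%N -> s j = j) \/ (forall j, (j <= k)%N -> s j = k - j)%N.
Proof.
move=> s_le s_inj s_adj; case: k => [|k] in s_le s_inj s_adj *.
  by left=> j; rewrite leqn0 => /eqP->; have := s_le 0%N (leqnn 0); lia.
(* Injectivity forbids turning back, so every unit step repeats the direction of the first; the
   bound [k] then determines the starting point. *)
have turn j : (j.+1 < k.+1)%N -> s j <> s j.+2.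
  by move=> lt_j /s_inj; move=> /(_ (ltnW (ltnW lt_j)) lt_j); lia.
have [s1|s1] := s_adj 0%N (ltn0Sn k); [left|right].
  have sE j : (j <= k.+1)%N -> s j = (s 0 + j)%N.
    elim/ltn_ind: j => -[|[|j]] IH lt_j; [lia|lia|].
    have := IH j.+1 (leqnn _) (ltnW lt_j).
    have := IH j (leqW (leqnn _)) (ltnW (ltnW lt_j)).
    by have := turn j lt_j; have := s_adj j.+1 lt_j; lia.
  move=> j le_j; have := s_le _ (leqnn k.+1); have := sE j le_j.
  by have := sE _ (leqnn k.+1); lia.
have sE j : (j <= k.+1)%N -> (s j + j = s 0)%N.
  elim/ltn_ind: j => -[|[|j]] IH lt_j; [lia|lia|].
  have := IH j.+1 (leqnn _) (ltnW lt_j).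
  have := IH j (leqW (leqnn _)) (ltnW (ltnW lt_j)).
  by have := turn j lt_j; have := s_adj j.+1 lt_j; lia.
move=> j le_j; have := sE j le_j; have := sE k.+1 (leqnn k.+1).
by have := s_le 0%N isT; lia.
Qed.

Section DiagonalAction.
Variables (R : idomainType) (n : nat).
Local Notation T := 'T[R]_n.+2.
Implicit Types (a : T) (k : nat) (l : T -> T).

Lemma lie_triple_diag l : linear l -> bijective l -> lie_triple_hom l ->
  exists2 s : R, s = 1 \/ s = -1 &
    (forall a i, l a i i - s * a i i = l a ord0 ord0 - s * a ord0 ord0) \/
    (forall a i, l a i i - s * a (rev_ord i) (rev_ord i) =
                 l a ord0 ord0 - s * a ord_max ord_max).
Proof.
move=> lin_l bij_l hom_l; have [l' lK l'K] := bij_l.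
pose d a k := a (inord k) (inord k).
pose al a k := d a k - d a k.+1.
have root k p : (0 < k)%N -> (p + k < n.+2)%N ->
    exists p' (e : R), [/\ (p' + k < n.+2)%N, e = 1 \/ e = -1
      & forall a, d (l a) p - d (l a) (p + k)%N = e * (d a p' - d a (p' + k)%N)].
  move=> k_gt0 lt_pk; have lt_p : (p < n.+2)%N by lia.
  have := @lie_triple_root _ _ l k (inord p) (inord (p + k)) lin_l bij_l hom_l k_gt0.
  rewrite !inordK // => /(_ erefl)[p' [q' [e [eq_q' e1 H]]]].
  exists p', e; split=> // [|a]; first by rewrite -eq_q'.
  by rewrite H /d -eq_q' !inord_val.
pose P (j : 'I_n.+1) (u : nat * R) := [/\ (u.1 < n.+1)%N, u.2 = 1 \/ u.2 = -1
  & forall a, al (l a) j = u.2 * al a u.1].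
have [f Hf] : exists f, forall j, P j (f j).
  apply: fin_all_exists => j; have [||p' [e [lt_p' e1 H]]] := @root 1%N j => //.
    by rewrite addn1 ltnS.
  exists (p', e); split=> //=; first by rewrite addn1 in lt_p'.
  by move=> a; rewrite /al -[j.+1]addn1 H addn1.
pose s j := (f (inord j)).1; pose e j := (f (inord j)).2.
have s_le j : (s j <= n)%N by have [] := Hf (inord j).
have e1 j : e j = 1 \/ e j = -1 by have [] := Hf (inord j).
have e0 j : e j != 0 by have [->|->] := e1 j; rewrite ?oppr_eq0 oner_eq0.
have alE j a : (j <= n)%N -> al (l a) j = e j * al a (s j).
  by move=> le_j; have [_ _ <-] := Hf (inord j); rewrite inordK.
pose w k : T := utmx (\matrix_(i, j) ((i == j) && (i <= k)%N)%:R).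
have dw k j : (j < n.+2)%N -> d (w k) j = (j <= k)%N%:R.
  by move=> lt_j; rewrite /d utmxE // mxE eqxx /= inordK.
have alw k j : (j <= n)%N -> al (w k) j = (j == k)%:R.
  move=> le_j; rewrite /al !dw //; last by lia.
  by case: (ltngtP j k) => _; rewrite ?subrr ?subr0.
(* If [s i = s j], the characters [i] and [j] have proportional pullbacks, but the preimage of [w i]
   separates them. *)
have s_inj i j : (i <= n)%N -> (j <= n)%N -> s i = s j -> i = j.
  move=> le_i le_j eq_s; apply/eqP/negPn/negP => ne_ij.
  have := alE i (l' (w i)) le_i; have := alE j (l' (w i)) le_j.
  rewrite l'K !alw // eqxx eq_sym (negPf ne_ij) eq_s => /esym/eqP.
  rewrite mulf_eq0 (negPf (e0 j)) => /eqP->.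
  by move/eqP; rewrite mulr0 oner_eq0.
(* The sum of two adjacent simple characters belongs to the second superdiagonal, so it pulls back
   to a signed sum of two adjacent ones. Evaluating at the dual matrices compares this with the
   separate pullbacks. *)
have step j : (j < n)%N -> (s j.+1 = (s j).+1 \/ s j = (s j.+1).+1) /\ e j = e j.+1.
  move=> lt_j; have [||t [c [lt_t c1 H]]] := @root 2%N j => //; first by lia.
  have Ha a : e j * al a (s j) + e j.+1 * al a (s j.+1) = c * (al a t + al a t.+1).
    rewrite -!alE //; last by lia.
    by have := H a; rewrite !addn2 /al !addrA !subrK.
  have ne_s : s j == s j.+1 = false.
    by apply/negbTE/eqP => /s_inj; move=> /(_ (ltnW lt_j) lt_j); lia.
  have := Ha (w (s j)); have := Ha (w (s j.+1)).
  rewrite !alw //; try lia.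
  rewrite !eqxx ne_s [_ == s j]eq_sym ne_s !mulr0 !mulr1 addr0 add0r.
  (* As [e i] is nonzero, one of [t] and [t.+1], and only one, equals [s i]. *)
  have pick i : e i = c * ((t == s i)%:R + (t.+1 == s i)%:R) ->
      e i = c /\ (s i = t \/ s i = t.+1).
    have := e0 i; case: (t =P s i) => [eq_t|_]; case: (t.+1 =P s i) => [eq_t1|_].
    - by move: eq_t1; rewrite -eq_t; lia.
    - by rewrite addr0 mulr1; split=> //; left.
    - by rewrite add0r mulr1; split=> //; right.
    - by move=> + ei; rewrite ei addr0 mulr0 eqxx.
  move=> /pick[-> s1] /pick[-> s2]; split=> //.
  by move/eqP: ne_s => ne_s; lia.
have eC j : (j <= n)%N -> e j = e 0%N.
  by elim: j => // j IHj lt_j; have [_ <-] := step j lt_j; apply/IHj/ltnW.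
have dE a i : a i i = d a i by rewrite /d inord_val.
have d_max a : a ord_max ord_max = d a n.+1 by exact: dE.
have d_0 a : a ord0 ord0 = d a 0%N by exact: dE.
have alS a j : (j <= n)%N -> d (l a) j.+1 = d (l a) j - e 0%N * al a (s j).
  by move=> le_j; rewrite -(eC j le_j) -alE // /al subKr.
have s_adj j (lt_j : (j < n)%N) := (step j lt_j).1.
have [sE|sE] := adjacent_injection (fun j _ => s_le j) s_inj s_adj.
  exists (e 0%N) => //; left=> a i; rewrite d_0 [a ord0 _]d_0 !dE.
  case: i => i /=; elim: i => // i IHi lt_i; rewrite -(IHi (ltnW lt_i)).
  by rewrite alS // sE // /al; ring.
(* Reversing the order of the diagonal negates each difference of neighbours, hence the opposite
   sign. *)
exists (- e 0%N); first by have [->|->] := e1 0%N; rewrite ?opprK; [right|left].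
right=> a i; rewrite d_0 d_max !dE.
case: i => i /=; elim: i => [|i IHi] lt_i; first by rewrite subn1.
rewrite -(IHi (ltnW lt_i)) alS // sE // /al.
have -> : (n.+2 - i.+1 = (n - i).+1)%N by lia.
have -> : (n.+2 - i.+2 = n - i)%N by lia.
ring.
Qed.
End DiagonalAction.

(** * Assembly: removing the sign and the reversal *)

Theorem corollary4p5 (R : idomainType) (half : (2%:R : R) \is a GRing.unit)
    (n : nat) (l : 'T[R]_n.+2 -> 'T[R]_n.+2)
    (hl : lie_triple_isomorphism l) :
  exists m nu : 'T[R]_n.+2 -> 'T[R]_n.+2,
    [/\ algebra_isomorphism m \/ algebra_anti_isomorphism m,
        linear nu,
        forall x, exists r : R, nu x = r%:A,
        forall x y z, nu (lie_bracket (lie_bracket x y) z) = 0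
      & (forall x, l x = m x + nu x) \/ (forall x, l x = - m x + nu x)].
Proof.
have [lin_l bij_l hom_l] := hl.
have [s s1 diag_l] := lie_triple_diag lin_l bij_l hom_l.
have ss : s * s = 1 by case: s1 => ->; rewrite ?mulrNN mulr1.
have sK : involutive (fun x : 'T[R]_n.+2 => s *: x).
  by move=> x; rewrite scalerA ss scale1r.
(* The cube of [s] is [s]. *)
have brZ : lie_triple_hom (fun x : 'T[R]_n.+2 => s *: x).
  by move=> a b c /=; rewrite !(bracketZl, bracketZr) scalerA ss scale1r.
(* A second multiplication by [s] recovers [l]; the sign stays visible on [m] and is absorbed into
   the scalar part. *)
have signed m nu : (forall x, s *: l x = m x + nu x) ->
    (forall x, l x = m x + s *: nu x) \/ (forall x, l x = - m x + s *: nu x).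
  by case: s1 sK => -> sK' E; [left|right] => x;
    rewrite -[LHS]sK' E !(scale1r, scaleN1r) // opprD.
have bijZ : bijective (fun x : 'T[R]_n.+2 => s *: x) by exists (fun x => s *: x).
have linZ (f : 'T[R]_n.+2 -> 'T[R]_n.+2) : linear f -> linear (fun x => s *: f x).
  by move=> lin_f r x y; rewrite lin_f scalerDr !scalerA mulrC.
have unip f : linear f -> bijective f -> lie_triple_hom f ->
    (forall x i, f x i i - s * x i i = f x ord0 ord0 - s * x ord0 ord0) ->
  exists m nu : 'T[R]_n.+2 -> 'T[R]_n.+2,
    [/\ algebra_isomorphism m, linear nu, forall x, exists r : R, nu x = r%:A,
        forall x y z, nu (lie_bracket (lie_bracket x y) z) = 0
      & forall x, s *: f x = m x + nu x].
  move=> lin_f bij_f hom_f diag_f; apply: lie_triple_unipotent => [||a b c|x i].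
  - exact: linZ.
  - exact: bij_comp bijZ bij_f.
  - by rewrite hom_f brZ.
  - by have := congr1 ( *%R s) (diag_f x i); rewrite !mulrBr !mulrA ss !mul1r !utZE.
have scal (nu : 'T[R]_n.+2 -> 'T[R]_n.+2) : (forall x, exists r : R, nu x = r%:A) ->
    forall x, exists r : R, s *: nu x = r%:A.
  by move=> H x; have [r ->] := H x; exists (s * r); rewrite scalerA.
have [D|D] := diag_l.
  have [m [nu [iso_m lin_nu nuA nu0 lE]]] := unip l lin_l bij_l hom_l D.
  exists m, (fun x => s *: nu x); split.
  - by left.
  - exact: linZ.
  - exact: scal.
  - by move=> x y z; rewrite nu0 scaler0.
  - exact: signed.
have bijA : bijective (@antitr R n.+1) := inv_bij (@antitrK R n.+1).
have linA := @antitr_linear R n.+1.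
(* Precomposing with [antitr] puts the diagonal back in order and reduces to the first case. *)
have [||a b c|x i|m [nu [iso_m lin_nu nuA nu0 lE]]] := unip (l \o @antitr R n.+1).
- by move=> r x y /=; rewrite linA lin_l.
- exact: bij_comp.
- by rewrite /= antitr_bracket2 hom_l.
- have := D (antitr x) i; rewrite /= !antitrE !rev_ordK => ->.
  by rewrite (_ : rev_ord ord_max = ord0) //; apply: ord_inj; rewrite /= subnn.
have [lin_m bij_m [m1 mM]] := iso_m.
(* Undoing the reflection, an involution, turns the isomorphism into an anti-isomorphism. *)
exists (m \o @antitr R n.+1), (fun x => s *: nu (antitr x)); split.
- right; split=> [r x y||x y] /=; first by rewrite linA lin_m.
    exact: bij_comp.
  by rewrite antitrM mM.
- by apply: (linZ (nu \o _)) => r x y /=; rewrite linA lin_nu.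
- by move=> x; apply: scal.
- by move=> x y z; rewrite antitr_bracket2 nu0 scaler0.
- by apply: (signed (m \o _) (nu \o _)) => x /=; rewrite -lE /= antitrK.
Qed.
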